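(* Let $X_1,\dots,X_n$ ($n\ge 2$) be independent real random variables with cumulative distribution functions $F_1,\dots,F_n$ belonging to a scale family: there exist a continuous cumulative distribution function $D$ on $\mathbb{R}$ and positive numbers $\sigma_1,\dots,\sigma_n$ such that $F_k(x)=D(x/\sigma_k)$ for all $x\in\mathbb{R}$ and $k=1,\dots,n$. Assume moreover that $D(0)=\frac12$ and that $D$ admits a continuous density function $d$. Let $M=\mathrm{Med}(X_1,\dots,X_n)$. If $n$ is even, then for all $t>0$, $$\mathbb{P}(|M|\ge t)\le 2\exp\bigg(-\Big(\sum_{k=1}^n\sigma_k^{-1}\Big)^2\cdot\frac{2t^2}{n}\cdot\min_{\substack{|u|\le t\\ 1\le k\le n}} d^2\Big(\frac{u}{\sigma_k}\Big)\bigg).$$ If $n$ is odd, then for all $t>0$ with $t\cdot\min_{|u|\le t,\,1\le k\le n} d(u/\sigma_k)\cdot\sum_{k=1}^n\sigma_k^{-1}\ge 2$, $$\mathbb{P}(|M|\ge t)\le 2\exp\bigg(-\Big(\sum_{k=1}^n\sigma_k^{-1}\Big)^2\cdot\frac{t^2}{2n}\cdot\min_{\substack{|u|\le t\\ 1\le k\le n}} d^2\Big(\frac{u}{\sigma_k}\Big)\bigg).$$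
   Context: Order statistics are in decreasing order: $X^{(1)}\ge\cdots\ge X^{(n)}$, so $X^{(j)}$ is the $j$-th largest of $X_1,\dots,X_n$. For $p\in(0,1)$ with $pn\ge1$, the $100(1-p)$%-th percentile of $X_1,\dots,X_n$ is $X^{(\lfloor pn\rfloor)}$; the median is the case $p=\frac12$, that is, $\mathrm{Med}(X_1,\dots,X_n)=X^{(\lfloor n/2\rfloor)}$. The notation $d^2(x)$ means $(d(x))^2$. *)

(* Defs.v *)
From mathcomp Require Import all_boot all_order all_algebra.
From mathcomp Require Import all_classical all_reals all_analysis.

Set Implicit Arguments.
Unset Strict Implicit.
Unset Printing Implicit Defensive.

Import Order.TTheory GRing.Theory Num.Theory.
Import numFieldNormedType.Exports.

Local Open Scope classical_set_scope.
Local Open Scope ring_scope.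

Definition mutually_independent (disp : measure_display)
    (T : measurableType disp) (R : realType) (P : probability T R)
    (I : finType) (X : I -> {RV P >-> R}) : Prop :=
  forall (J : {set I}) (B : I -> set R), (forall i, measurable (B i)) ->
    P (\bigcap_(i in [set` J]) (X i @^-1` B i)) =
    (\prod_(i in J) P (X i @^-1` B i))%E.

(* [order_stat x j] is the [j]-th largest value, counted from 1; it is
   meaningful only for [1 <= j <= n]. *)
Definition order_stat (R : realType) (n : nat) (x : 'I_n -> R) (j : nat) : R :=
  nth 0 (sort >=%R [seq x k | k <- enum 'I_n]) j.-1.

(* For odd [n] this is the value just above the middle one. *)
Definition median (R : realType) (n : nat) (x : 'I_n -> R) : R :=
  order_stat x n./2.

Definition is_density (R : realType) (D d : R -> R) : Prop :=
  [/\ measurable_fun [set: R] d, (forall x, 0 <= d x) &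
      forall x, (D x)%:E =
        (\int[@lebesgue_measure R]_(y in `]-oo, x]) (d y)%:E)%E].

Definition scaled_values (R : realType) (n : nat) (sigma : 'I_n -> R)
    (f : R -> R) (t : R) : set R :=
  [set f (u / sigma k) | u in [set u | `|u| <= t] & k in [set: 'I_n]].

(* The minimum of [f (u / sigma k)] over [|u| <= t] and [k]; the lemma below
   shows that the infimum is attained when [f] is continuous. *)
Definition min_scaled (R : realType) (n : nat) (sigma : 'I_n -> R)
    (f : R -> R) (t : R) : R :=
  inf (scaled_values sigma f t).

Lemma min_scaledP (R : realType) (n : nat) (sigma : 'I_n -> R) (f : R -> R)
    (t : R) : (0 < n)%N -> 0 <= t -> continuous f ->
  scaled_values sigma f t (min_scaled sigma f t) /\
  lbound (scaled_values sigma f t) (min_scaled sigma f t).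
Proof.
move=> n0 t0 cf.
suff [m mA mlb] : exists2 m, scaled_values sigma f t m &
    lbound (scaled_values sigma f t) m.
  have -> : min_scaled sigma f t = m; last by [].
  apply/eqP; rewrite eq_le; apply/andP; split.
    by apply: ge_inf => //; exists m.
  by apply: lb_le_inf => //; exists m.
have H k : exists2 c, `|c| <= t &
    forall u, `|u| <= t -> f (c / sigma k) <= f (u / sigma k).
  have ab : - t <= t by rewrite ge0_cp.
  have : {within `[- t, t], continuous (fun u => f (u / sigma k))}.
    apply: continuous_subspaceT.
    have cg : continuous (fun u : R => u / sigma k).
      by move=> u; apply: cvgMr_tmp; exact: cvg_id.
    by move=> u; exact: (continuous_comp (cg u) (cf _)).
  move=> /(EVT_min ab)[c]; rewrite in_itv/= -ler_norml => ct cmin.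
  by exists c => // u ut; apply: cmin; rewrite in_itv/= -ler_norml.
pose c k := sval (cid2 (H k)).
have ct k : `|c k| <= t by rewrite /c; case: cid2.
have cmin k u : `|u| <= t -> f (c k / sigma k) <= f (u / sigma k).
  by rewrite /c; case: cid2 => /= ? _; exact.
have [k0 _ k0min] : exists2 k0 : 'I_n, true &
    forall k, true -> f (c k0 / sigma k0) <= f (c k / sigma k).
  by case: (arg_minP (fun k => f (c k / sigma k)) (erefl : xpredT (Ordinal n0)))
    => k0 _ k0min; exists k0.
exists (f (c k0 / sigma k0)).
  exists (c k0); first exact: ct.
  by exists k0.
by move=> _ [u ut [k _ <-]]; exact: (le_trans (k0min k _) (cmin k u ut)).
Qed.

(* Main.v *)
Require Import Defs.
From mathcomp Require Import all_boot all_order all_algebra.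
From mathcomp Require Import all_classical all_reals all_analysis.
From mathcomp Require Import measurable_realfun.
From mathcomp Require Import ring lra zify.

(** Fix [t > 0] and let [m] be the minimum of [d (u / sigma k)] over
[|u| <= t] and [k]. Since [D 0 = 1 / 2] and [d >= m] on the segment from 0 to
[t / sigma k], each of the events [X k >= t] and [X k <= - t] has probability
at most [1 / 2 - m * t / sigma k] ([upper_tail], [lower_tail]).

The median is at least [t] exactly when at least [n./2] of the variables are,
and at most [- t] exactly when at least [(n - n./2).+1 >= n./2] of them are at
most [- t] ([le_order_stat], [order_stat_le]). Either event therefore forces a
sum of independent indicators, of mean at most [n / 2 - m * t * S] with
[S] the sum of the [(sigma k)^-1], to reach [n./2]. Hoeffding's inequality
bounds the probability of this by [exp (- 2 e ^ 2 / n)] whenever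
[0 <= e <= m * t * S - (n / 2 - n./2)], and the two events account for the factor 2
in the result ([median_tail]). For even [n] one takes [e = m * t * S]. For odd
[n] half a unit is lost in [n./2], and [e = m * t * S / 2] is
admissible because [m * t * S >= 1].

Hoeffding's inequality is obtained without integrals. The set of indices whose
event occurs takes finitely many values, and by independence the value [J] has
probability [\prod_i (if i \in J then p i else 1 - p i)]. Summing these with
the weights [exp (l * (#|J| - j))], which are at least 1 once [#|J| >= j],
gives [exp (- l * j) * \prod_i (1 - p i + p i * exp l)] by distributivity
([chernoff_hits]); Hoeffding's lemma for a Bernoulli variable
([bernoulli_mgf_le]) and the optimal [l] conclude ([hoeffding_hits]). *)

Set Implicit Arguments.
Unset Strict Implicit.
Unset Printing Implicit Defensive.

Import Order.TTheory GRing.Theory Num.Theory.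
Import numFieldNormedType.Exports.

Local Open Scope classical_set_scope.
Local Open Scope ring_scope.

(** * Hoeffding's lemma for a Bernoulli variable *)

Lemma le_of_derive_ge0 (R : realType) (f df : R -> R) (b : R) :
  (forall x : R, is_derive x (1 : R) f (df x)) ->
  (forall x, 0 <= x -> 0 <= df x) ->
  0 <= b -> f 0 <= f b.
Proof.
move=> fdf df0 b0.
have cf : {within `[0, b], continuous f}.
  apply: continuous_subspaceT => x.
  by apply: differentiable_continuous; apply/derivable1_diffP; have [] := fdf x.
have [c] := MVT_segment b0 (fun x _ => fdf x) cf.
rewrite in_itv/= subr0 => /andP[c0 _] e.
by rewrite -subr_ge0 e mulr_ge0 ?df0.
Qed.

(** Hoeffding's lemma for a Bernoulli variable. The derivative of
[x |-> ln (1 - q + q * exp x)] is the logistic function [u] with [u 0 = q],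
which solves [u' = u * (1 - u) <= 1 / 4]. Two integrations from 0 give
[u x <= q + x / 4] and then the bound on the logarithm. *)
Lemma bernoulli_mgf_le (R : realType) (q l : R) : 0 <= q <= 1 -> 0 <= l ->
  1 - q + q * expR l <= expR (l * q + l ^+ 2 / 8).
Proof.
move=> /andP[q0 q1] l0.
pose h (x : R) := 1 - q + q * expR x.
have h_gt0 x : 0 < h x by rewrite /h; have := expR_gt0 x => ?; nra.
have dh (x : R) : is_derive x (1 : R) h (h x - (1 - q)).
  rewrite /h; apply: is_derive_eq; rewrite /GRing.scale/=; ring.
pose u x : R := 1 - (1 - q) * (h x)^-1.
have h0 : h 0 = 1 by rewrite /h expR0; ring.
have u_le x : 0 <= x -> u x <= q + x / 4.
  move=> x0.
  have := @le_of_derive_ge0 _ (fun x => q + x / 4 - u x)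
    (fun x => 1 / 4 - u x * (1 - u x)) x.
  rewrite [u 0]/u h0 invr1 => H.
  rewrite -subr_ge0; apply: le_trans (H _ _ x0); first lra.
  - move=> y; have hn := h_gt0 y; rewrite /u.
    have := is_deriveV (lt0r_neq0 hn) (dh y) => dV.
    apply: is_derive_eq; rewrite !scaler1 /GRing.scale/=; field; lra.
  - by move=> y _; move: (u y) => v; have := sqr_ge0 (v - 1 / 2); nra.
have H := @le_of_derive_ge0 _ (fun x => x * q + x ^+ 2 / 8 - ln (h x))
  (fun x => q + x / 4 - u x) l.
rewrite -[leLHS](@lnK _ (h l)) ?posrE// ler_expR -subr_ge0.
apply: le_trans (H _ _ l0); first by rewrite h0 ln1; lra.
- move=> y; have hn := h_gt0 y; rewrite /u.
  have dl := is_derive1_comp (is_derive1_ln hn) (dh y).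
  apply: is_derive_eq; rewrite !scaler1 /GRing.scale/=; field; lra.
- by move=> y y0; rewrite subr_ge0 u_le.
Qed.

(** * Hoeffding's inequality for the number of events that occur *)

Section hits.
Variables (disp : measure_display) (T : measurableType disp) (R : realType).
Variables (P : probability T R) (I : finType) (X : I -> {RV P >-> R}).
Variables (B : I -> set R).
Hypothesis mB : forall i, measurable (B i).

Definition hits (w : T) : {set I} := [set i | X i w \in B i]%SET.

Let target (J : {set I}) i := if i \in J then B i else ~` B i.

Let measurable_target J i : measurable (target J i).
Proof. by rewrite /target; case: ifP => _ //; exact: measurableC. Qed.

Lemma hits_eqE (J : {set I}) :
  [set w | hits w = J] =
  \bigcap_(i in [set` [set: I]%SET]) (X i @^-1` target J i).
Proof.
apply/seteqP; split => w /=.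
  move=> <- i _; rewrite /target /= inE; case: ifPn => [/set_mem//|].
  by rewrite notin_setE.
move=> H; apply/setP => i; rewrite inE.
have := H i; rewrite /= /target inE => /(_ isT); case: ifP => _.
  exact: mem_set.
by move=> nB; apply/negbTE; rewrite notin_setE.
Qed.

Lemma measurable_hits_eq (J : {set I}) : measurable [set w | hits w = J].
Proof.
rewrite hits_eqE; apply: fin_bigcap_measurable; first exact: finite_finset.
by move=> i _; exact: measurable_funPTI.
Qed.

Lemma card_hitsE (j : nat) :
  [set w | (j <= #|hits w|)%N] =
  \big[setU/set0]_(J : {set I} | (j <= #|J|)%N) [set w | hits w = J].
Proof.
rewrite -bigcup_pred; apply/seteqP; split=> [w jw|w [J jJ /= wJ]].
  by exists (hits w).
by rewrite /= wJ.
Qed.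

Lemma measurable_card_hits (j : nat) : measurable [set w | (j <= #|hits w|)%N].
Proof.
rewrite card_hitsE; apply: bigsetU_measurable => J _.
exact: measurable_hits_eq.
Qed.

Lemma prob_card_hits_le (j : nat) :
  (P [set w | (j <= #|hits w|)%N] <=
   \sum_(J : {set I} | (j <= #|J|)%N) P [set w | hits w = J])%E.
Proof.
rewrite card_hitsE; set U := \big[setU/set0]_(_ | _) _.
(* Subadditivity asks for measurable sets, hence the stronger induction. *)
suff [] : measurable U /\
    (P U <= \sum_(J : {set I} | (j <= #|J|)%N) P [set w | hits w = J])%E by [].
rewrite /U; elim/big_ind2 : _ => [|A a A' a' [mA Aa] [mA' Aa']|J _].
- by rewrite measure0.
- split; first exact: measurableU.
  by apply: le_trans (measureU2 _ mA mA') _; exact: leeD.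
- by split=> //; exact: measurable_hits_eq.
Qed.

(** [hits w = J] says that each [X i w] lies in [B i] or in its complement,
so the product rule for all of [I] already decides its probability. *)
Lemma prob_hits_eq (p : I -> R) (J : {set I}) : mutually_independent X ->
  (forall i, P (X i @^-1` B i) = (p i)%:E) ->
  P [set w | hits w = J] = (\prod_i (if i \in J then p i else 1 - p i))%:E.
Proof.
move=> hX Pp; rewrite hits_eqE hX// -prodEFin.
apply: eq_big => [i|i _]; first by rewrite inE.
rewrite /target; case: ifP => _; first exact: Pp.
rewrite -preimage_setC probability_setC; last exact: measurable_funPTI.
by rewrite Pp.
Qed.

(** Exponential Chebyshev inequality: a set [J] with at least [j] elements
satisfies [1 <= exp (l * (#|J| - j))], and the weighted sum over all [J]
factors. *)
Lemma chernoff_hits (p : I -> R) (j : nat) (l : R) : mutually_independent X ->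
  (forall i, P (X i @^-1` B i) = (p i)%:E) -> 0 <= l ->
  (P [set w | (j <= #|hits w|)%N] <=
   (expR (- (l * j%:R)) * \prod_i (1 - p i + p i * expR l))%:E)%E.
Proof.
move=> hX Pp l0.
have p0 i : 0 <= p i by rewrite -lee_fin -Pp.
have p1 i : 0 <= 1 - p i.
  by rewrite subr_ge0 -lee_fin -Pp probability_le1//; exact: measurable_funPTI.
apply: le_trans (prob_card_hits_le j) _.
rewrite (eq_bigr _ (fun J _ => prob_hits_eq J hX Pp)).
rewrite (eq_bigr _ (fun i _ => addrC (1 - p i) (p i * expR l))).
rewrite sumEFin lee_fin bigA_distr mulr_sumr big_mkcond/=.
apply: ler_sum => J _.
have -> : \prod_i (if i \in J then p i * expR l else 1 - p i) =
    expR (l * #|J|%:R) * \prod_i (if i \in J then p i else 1 - p i).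
  rewrite expRM_natr -prodr_const [X in X * _]big_mkcond -big_split/=.
  by apply: eq_bigr => i _; case: ifP => _; rewrite ?mul1r 1?mulrC.
rewrite mulrA -expRD.
have q0 : 0 <= \prod_i (if i \in J then p i else 1 - p i).
  by apply: prodr_ge0 => i _; case: ifP.
case: ifP => [jJ|_]; last by rewrite mulr_ge0// expR_ge0.
rewrite ler_peMl// -[leLHS]expR0 ler_expR addrC subr_ge0.
by rewrite ler_wpM2l// ler_nat.
Qed.

(** Upper bounds [q] on the probabilities suffice, because
[1 - p + p * exp l] increases with [p] when [l >= 0]. *)
Lemma hoeffding_hits (q : I -> R) (j : nat) : mutually_independent X ->
  (0 < #|I|)%N -> (forall i, (P (X i @^-1` B i) <= (q i)%:E)%E) ->
  (forall i, q i <= 1) -> \sum_i q i <= j%:R ->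
  (P [set w | (j <= #|hits w|)%N] <=
    (expR (- (2 * (j%:R - \sum_i q i) ^+ 2 / #|I|%:R)))%:E)%E.
Proof.
move=> hX I0 Pq q1 qj.
set s := \sum_i q i in qj *; set n : R := #|I|%:R.
have n0 : 0 < n by rewrite ltr0n.
have Pp i : P (X i @^-1` B i) = (fine (P (X i @^-1` B i)))%:E.
  by rewrite fineK// fin_num_measure//; exact: measurable_funPTI.
have p0 i : 0 <= fine (P (X i @^-1` B i)) by apply: fine_ge0.
have pq i : fine (P (X i @^-1` B i)) <= q i by rewrite -lee_fin -Pp.
(* The minimizer of the exponent [- l * (j - s) + n * l ^+ 2 / 8]. *)
pose l := 4 * (j%:R - s) / n.
have l0 : 0 <= l by rewrite /l divr_ge0 ?(ltW n0)// mulr_ge0 ?subr_ge0.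
apply: le_trans (chernoff_hits j hX Pp l0) _; rewrite lee_fin.
apply: (@le_trans _ _ (expR (- (l * j%:R)) *
    \prod_i expR (l * q i + l ^+ 2 / 8))).
  rewrite ler_pM2l ?expR_gt0//; apply: ler_prod => i _.
  have e1 : 1 <= expR l by rewrite -expR0 ler_expR.
  have := p0 i; have := pq i; have := q1 i; move: (fine _) => p ? ? ?.
  apply/andP; split; first nra.
  apply: le_trans (bernoulli_mgf_le _ l0); last by apply/andP; split => //; lra.
  nra.
rewrite -expR_sum -expRD ler_expR big_split/= -mulr_sumr sumr_const.
rewrite -mulr_natr -/n -/s.
by rewrite /l le_eqVlt; apply/orP; left; apply/eqP; field; lra.
Qed.
End hits.

(** * Order statistics and counting *)

(** In a decreasing sequence the entries with an upward closed property [p]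
form an initial segment. *)
Lemma nth_sorted_upset (R : realType) (p : pred R) (s : seq R) i :
  (forall y z, y <= z -> p y -> p z) -> sorted >=%R s -> (i < size s)%N ->
  p (nth 0 s i) = (i < count p s)%N.
Proof.
move=> p_up; elim: s i => [//|y s IH] i /=.
rewrite (path_sortedE (rev_trans le_trans)) => /andP[/allP ys ss].
have count0 : ~~ p y -> count p s = 0%N.
  move=> py; apply/eqP; rewrite -leqn0 leqNgt -has_count; apply/hasPn => z zs.
  by apply: contra py; exact: p_up (ys _ zs).
case: i => [|i] /= i_s; first by case: (boolP (p y)) => // /count0 ->.
by rewrite IH//; case: (boolP (p y)) => // /count0 ->; rewrite ltn0.
Qed.

Lemma count_map_enum (I : finType) (S : Type) (p : pred S) (x : I -> S) :
  count p [seq x k | k <- enum I] = #|[pred k | p (x k)]|.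
Proof. by rewrite count_map enumT cardE size_filter. Qed.

Section order_stat.
Variables (R : realType) (n : nat) (x : 'I_n -> R) (j : nat).
Hypothesis jn : (0 < j <= n)%N.

Let order_stat_upset (p : pred R) : (forall y z, y <= z -> p y -> p z) ->
  p (order_stat x j) = (j <= #|[pred k | p (x k)]|)%N.
Proof.
case/andP: jn => j0 le_jn p_up; rewrite /order_stat nth_sorted_upset//.
- by rewrite prednK// count_sort count_map_enum.
- by apply: sort_sorted => u v; exact: le_total.
- by rewrite size_sort size_map size_enum_ord prednK.
Qed.

Lemma le_order_stat (a : R) :
  (a <= order_stat x j) = (j <= #|[pred k | (a <= x k)%R]|)%N.
Proof.
by apply: (order_stat_upset (p := >= a)) => y z yz /= ay; exact: le_trans yz.
Qed.

Lemma order_stat_le (a : R) :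
  (order_stat x j <= a) = (n - j < #|[pred k | (x k <= a)%R]|)%N.
Proof.
have : (a < order_stat x j) = (j <= #|[pred k | (a < x k)%R]|)%N.
  by apply: (order_stat_upset (p := > a)) => y z yz /= ay;
    exact: lt_le_trans yz.
rewrite leNgt => ->.
have := cardC [pred k | (x k <= a)%R]; rewrite card_ord.
have -> : #|[predC [pred k | (x k <= a)%R]]| = #|[pred k | (a < x k)%R]|.
  by apply: eq_card => k; rewrite !inE ltNge.
by case/andP: jn; move: #|_| #|_| => u v; lia.
Qed.
End order_stat.

(** * One-sided tails of a scaled variable *)

Lemma density_gap (R : realType) (D d : R -> R) (m a b : R) :
  is_density D d -> a <= b -> (forall y, a <= y <= b -> m <= d y) -> 0 <= m ->
  m * (b - a) <= D b - D a.
Proof.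
move=> [md d0 Dd] ab dm m0.
rewrite -lee_fin EFinB.
have -> : (D b)%:E =
    ((D a)%:E + \int[@lebesgue_measure R]_(y in `]a, b]) (d y)%:E)%E.
  rewrite !Dd -ge0_integral_setU//=.
  - congr integral; apply/seteqP; split=> y /=; rewrite !in_itv/=.
      by case: (leP y a) => [|ay yb]; [left|right].
    by case=> [/le_trans -> //|/andP[]].
  - by apply/measurable_EFinP; exact: measurable_funS md.
  - by move=> y _; rewrite lee_fin.
  - rewrite disj_set2E; apply/eqP/seteqP; split=> y //= [].
    by rewrite !in_itv/= => ya /andP[]; rewrite ltNge ya.
rewrite addeAC subee// add0e.
apply: (@le_trans _ _ (\int[@lebesgue_measure R]_(y in `]a, b]) m%:E)%E);
    last first.
  apply: ge0_le_integral => //=.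
  - by apply/measurable_EFinP; exact: measurable_funS md.
  - move=> y /=; rewrite in_itv/= lee_fin => /andP[/ltW ay yb].
    by apply: dm; rewrite ay yb.
rewrite [leRHS](_ : _ = (m%:E * (@lebesgue_measure R) `]a, b])%E); last first.
  exact: integral_cst.
rewrite lebesgue_measure_itv/= lte_fin.
case: ltP => ab'; first by rewrite EFinM EFinB.
by rewrite mule0 lee_fin mulr_ge0_le0// subr_le0.
Qed.

(** The distribution function only controls the events [X > s], and
[X >= t] lies in all of those with [s < t]; the bound at [t] follows because
the bounds at [s] depend continuously on [s]. *)
Lemma upper_tail (disp : measure_display) (T : measurableType disp)
    (R : realType) (P : probability T R) (X : {RV P >-> R})
    (D d : R -> R) (sigma m t : R) :
  is_density D d -> D 0 = 1 / 2 -> 0 < sigma ->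
  (forall x, cdf X x = (D (x / sigma))%:E) -> 0 < t -> 0 <= m ->
  (forall u, `|u| <= t -> m <= d (u / sigma)) ->
  (P (X @^-1` `[t, +oo[%classic) <= (1 / 2 - m * t / sigma)%:E)%E.
Proof.
move=> Dd D0 sigma0 XD t0 m0 md.
have mX (A : set R) : measurable A -> measurable (X @^-1` A).
  by move=> mA; exact: measurable_funPTI.
set pt := P _.
have -> : pt = (fine pt)%:E.
  by rewrite fineK// fin_num_measure//; exact: mX.
have ps s : 0 <= s < t -> fine pt <= 1 / 2 - m / sigma * s.
  move=> /andP[s0 st].
  have H : 1 - D (s / sigma) <= 1 / 2 - m / sigma * s.
    have := @density_gap _ D d m 0 (s / sigma) Dd _ _ m0.
    rewrite D0 subr0 => H.
    suff: m * (s / sigma) <= D (s / sigma) - 1 / 2.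
      have -> : m / sigma * s = m * (s / sigma) by field; lra.
      lra.
    apply: H; first by rewrite divr_ge0// ltW.
    move=> y /andP[y0 ys].
    have -> : y = (y * sigma) / sigma by field; lra.
    apply: md; rewrite ger0_norm ?mulr_ge0// ?(ltW sigma0)//.
    by move: ys; rewrite ler_pdivlMr// => /le_trans; apply; exact: ltW.
  apply: le_trans H; rewrite -lee_fin fineK; last first.
    by rewrite fin_num_measure//; exact: mX.
  rewrite EFinB -XD.
  have -> : cdf X s = P (X @^-1` `]-oo, s]) by [].
  rewrite -probability_setC; last exact: mX.
  apply: le_measure; rewrite ?inE; first exact: mX.
    by apply: measurableC; exact: mX.
  move=> w /=; rewrite !in_itv/= andbT => tX.
  by apply/negP; rewrite -ltNge (lt_le_trans st).
rewrite lee_fin leNgt; apply/negP => lt_p.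
have c0 : 0 <= m / sigma by rewrite divr_ge0// ltW.
have E : m * t / sigma = m / sigma * t by field; lra.
rewrite {}E in lt_p; move: (m / sigma) c0 ps lt_p => c c0.
move: (fine _) => p ps lt_p.
have p_half : p <= 1 / 2 by have := ps 0; rewrite lexx t0 mulr0 subr0; exact.
have cp : 0 < c by nra.
(* If [p] exceeded the bound by a gap [g], then the bound at the point [s]
   chosen here would already be [p - g / 2]. *)
pose s := t - (p - 1 / 2 + c * t) / (2 * c).
have cs : c * s = (c * t + 1 / 2 - p) / 2 by rewrite /s; field; lra.
have := ps s.
have s0 : 0 <= s by nra.
have st : s < t by nra.
rewrite s0 st => /(_ isT); rewrite cs; lra.
Qed.

Lemma lower_tail (disp : measure_display) (T : measurableType disp)
    (R : realType) (P : probability T R) (X : {RV P >-> R})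
    (D d : R -> R) (sigma m t : R) :
  is_density D d -> D 0 = 1 / 2 -> 0 < sigma ->
  (forall x, cdf X x = (D (x / sigma))%:E) -> 0 < t -> 0 <= m ->
  (forall u, `|u| <= t -> m <= d (u / sigma)) ->
  (P (X @^-1` `]-oo, (- t)%R]%classic) <= (1 / 2 - m * t / sigma)%:E)%E.
Proof.
move=> Dd D0 sigma0 XD t0 m0 md.
have -> : P (X @^-1` `]-oo, - t]) = cdf X (- t) by [].
rewrite XD lee_fin.
have := @density_gap _ D d m (- t / sigma) 0 Dd _ _ m0.
rewrite D0 => H.
suff: m * (0 - - t / sigma) <= 1 / 2 - D (- t / sigma).
  have -> : m * t / sigma = m * (0 - - t / sigma) by field; lra.
  lra.
apply: H; first by rewrite ler_pdivrMr// mul0r; lra.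
move=> y /andP[ty y0].
have -> : y = (y * sigma) / sigma by field; lra.
apply: md; move: ty; rewrite ler_pdivrMr// => ty.
rewrite ler_norml; apply/andP; split; nra.
Qed.

(** * Tails of the median *)

(** Each side of the median gives an event of at least [n./2] hits. The lower
one even has [(n - n./2).+1] of them, because [median] is the [n./2]-th
largest value; keeping only [n./2] lets one bound serve both. *)
Lemma median_tail (disp : measure_display) (T : measurableType disp)
    (R : realType) (P : probability T R) (n : nat) (X : 'I_n -> {RV P >-> R})
    (q : 'I_n -> R) (e t : R) : (2 <= n)%N ->
  mutually_independent X ->
  (forall k, (P (X k @^-1` `[t, +oo[%classic) <= (q k)%:E)%E) ->
  (forall k, (P (X k @^-1` `]-oo, (- t)%R]%classic) <= (q k)%:E)%E) ->
  (forall k, q k <= 1) ->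
  0 <= e -> \sum_k q k + e <= n./2%:R ->
  (P [set w | (t <= `|median (fun k => X k w)|)%R] <=
    (2 * expR (- (2 * e ^+ 2 / n%:R)))%:E)%E.
Proof.
move=> n2 hX up lo q1 e0 qe.
have n2n : (0 < n./2 <= n)%N by lia.
have nn2 : (n./2 <= (n - n./2).+1)%N by lia.
pose U (k : 'I_n) : set R := `[t, +oo[%classic.
pose L (k : 'I_n) : set R := `]-oo, - t]%classic.
have mU k : measurable (U k) by exact: measurable_itv.
have mL k : measurable (L k) by exact: measurable_itv.
have cardU w : #|hits X U w| = #|[pred k | (t <= X k w)%R]|.
  rewrite cardsE; apply: eq_card => k; rewrite unfold_in; apply/idP/idP.
    by move/set_mem; rewrite /U/= in_itv/= andbT.
  by rewrite inE => tX; apply/mem_set; rewrite /U/= in_itv/= andbT.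
have cardL w : #|hits X L w| = #|[pred k | (X k w <= - t)%R]|.
  rewrite cardsE; apply: eq_card => k; rewrite unfold_in; apply/idP/idP.
    by move/set_mem; rewrite /L/= in_itv/=.
  by rewrite inE => tX; apply/mem_set; rewrite /L/= in_itv.
have -> : [set w | (t <= `|median (fun k => X k w)|)%R] =
    [set w | (n./2 <= #|hits X U w|)%N] `|`
    [set w | ((n - n./2).+1 <= #|hits X L w|)%N].
  apply/seteqP; split=> w /=;
    rewrite ler_normr lerNr le_order_stat// order_stat_le// cardU cardL.
    by move/orP.
  by move=> ?; exact/orP.
have tail B : (forall k, measurable (B k)) ->
    (forall k, (P (X k @^-1` B k) <= (q k)%:E)%E) ->
    (P [set w | (n./2 <= #|hits X B w|)%N] <=
      (expR (- (2 * e ^+ 2 / n%:R)))%:E)%E.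
  move=> mB qB.
  have n0 : 0 < n%:R :> R by rewrite ltr0n; lia.
  apply: (le_trans (hoeffding_hits mB hX _ qB q1 _)); rewrite ?card_ord//.
  - lia.
  - lra.
  rewrite lee_fin ler_expR lerN2 ler_pM2r ?invr_gt0// ler_pM2l//.
  by rewrite ler_sqr ?nnegrE//; lra.
have mLj j := measurable_card_hits X mL j.
apply: (le_trans (measureU2 _ (measurable_card_hits X mU _) (mLj _))).
rewrite -[2%R]/(1 + 1) mulrDl mul1r EFinD; apply: leeD; first exact: tail.
apply: le_trans (tail _ mL lo); apply: le_measure; rewrite ?inE//.
by move=> w /=; exact: leq_trans.
Qed.

(** The expected number of variables beyond [t] on one side is at most
[n / 2 - t * m * S], with [S] the sum in the statement. How far this lies below
[n./2] depends on the parity of [n], so the distance used is left as a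
parameter [e]. *)
Lemma min_scaled_tail (disp : measure_display) (T : measurableType disp)
    (R : realType) (P : probability T R) (n : nat) (X : 'I_n -> {RV P >-> R})
    (D d : R -> R) (sigma : 'I_n -> R) (e t : R) (m := min_scaled sigma d t) :
  (2 <= n)%N -> mutually_independent X -> (forall k, 0 < sigma k) ->
  (forall k x, cdf (X k) x = (D (x / sigma k))%:E) -> D 0 = 1 / 2 ->
  continuous d -> is_density D d -> 0 < t -> 0 <= e ->
  n%:R / 2 - t * m * (\sum_(k < n) (sigma k)^-1) + e <= n./2%:R ->
  (P [set w | (t <= `|median (fun k => X k w)|)%R] <=
    (2 * expR (- (2 * e ^+ 2 / n%:R)))%:E)%E.
Proof.
move=> n2 hX s0 XD D0 cd Dd t0 e0 eS.
have [[c ct [k0 _ cm]] lbm] := min_scaledP sigma (ltnW n2) (ltW t0) cd.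
have m0 : 0 <= m by rewrite /m -cm; case: Dd.
have md k u : `|u| <= t -> m <= d (u / sigma k).
  by move=> ut; apply: lbm; exists u => //; exists k.
apply: (@median_tail _ _ _ _ _ X (fun k => 1 / 2 - m * t / sigma k)) => //.
- by move=> k; exact: (upper_tail Dd D0 (s0 k) (XD k) t0 m0 (md k)).
- by move=> k; exact: (lower_tail Dd D0 (s0 k) (XD k) t0 m0 (md k)).
- move=> k; have : 0 <= m * t / sigma k by rewrite divr_ge0 ?mulr_ge0// ltW.
  lra.
- apply: le_trans eS; rewrite lerD2r sumrB sumr_const card_ord -mulr_sumr.
  rewrite -mulr_natl; lra.
Qed.

(** The minimum of [d] is attained, and the square of that value competes in
the minimum of the squares. *)
Lemma min_scaled_sqr_le (R : realType) (n : nat) (sigma : 'I_n -> R)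
    (d : R -> R) (t : R) : (0 < n)%N -> 0 <= t -> continuous d ->
  min_scaled sigma (fun x => d x ^+ 2) t <= min_scaled sigma d t ^+ 2.
Proof.
move=> n0 t0 cd.
have [[c ct [k _ <-]] _] := min_scaledP sigma n0 t0 cd.
have cd2 : continuous (fun x => d x ^+ 2).
  move=> x; apply: (@continuous_comp _ _ _ d (fun y => y ^+ 2)).
    exact: cd.
  exact: exprn_continuous.
have [_ lb] := min_scaledP sigma n0 t0 cd2.
by apply: lb; exists c => //; exists k.
Qed.

Theorem theorem5 (R : realType) (disp : measure_display)
    (T : measurableType disp) (P : probability T R)
    (n : nat) (hn : (2 <= n)%N) (X : 'I_n -> {RV P >-> R})
    (hX : mutually_independent X)
    (D : cumulativeBounded (0 : R) (1 : R)) (hD : continuous D)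
    (sigma : 'I_n -> R) (hsigma : forall k, 0 < sigma k)
    (hF : forall k x, cdf (X k) x = (D (x / sigma k))%:E)
    (hD0 : D 0 = 1 / 2)
    (d : R -> R) (hd : continuous d) (hDd : is_density D d) :
  (~~ odd n -> forall t : R, 0 < t ->
    (P [set w | (t <= `|median (fun k => X k w)|)%R] <=
     (2 * expR (- ((\sum_(k < n) (sigma k)^-1) ^+ 2 * (2 * t ^+ 2 / n%:R) *
                   min_scaled sigma (fun x => d x ^+ 2) t)))%R%:E)%E) /\
  (odd n -> forall t : R, 0 < t ->
    2 <= t * min_scaled sigma d t * \sum_(k < n) (sigma k)^-1 ->
    (P [set w | (t <= `|median (fun k => X k w)|)%R] <=
     (2 * expR (- ((\sum_(k < n) (sigma k)^-1) ^+ 2 * (t ^+ 2 / (2 * n%:R)) *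
                   min_scaled sigma (fun x => d x ^+ 2) t)))%R%:E)%E).
Proof.
set S := \sum_(k < n) (sigma k)^-1.
have n0 : (0 < n)%N by exact: ltnW.
have nR : 0 < n%:R :> R by rewrite ltr0n.
have S0 : 0 <= S by apply: sumr_ge0 => k _; rewrite invr_ge0 ltW.
have half : n%:R / 2 = n./2%:R + (odd n)%:R / 2 :> R.
  by rewrite -[in LHS](odd_double_half n) natrD -muln2 natrM; lra.
have tail e t : 0 < t -> 0 <= e ->
    (odd n)%:R / 2 + e <= t * min_scaled sigma d t * S ->
    (P [set w | (t <= `|median (fun k => X k w)|)%R] <=
      (2 * expR (- (2 * e ^+ 2 / n%:R)))%:E)%E.
  move=> t0 e0 eS.
  apply: (min_scaled_tail hn hX hsigma hF hD0 hd hDd t0 e0).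
  by rewrite -/S half; lra.
have sqr t c : 0 < t -> 0 <= c ->
    S ^+ 2 * (c * t ^+ 2) * min_scaled sigma (fun x => d x ^+ 2) t <=
    c * (t * min_scaled sigma d t * S) ^+ 2.
  move=> t0 c0.
  have -> : c * (t * min_scaled sigma d t * S) ^+ 2 =
    S ^+ 2 * (c * t ^+ 2) * min_scaled sigma d t ^+ 2 by ring.
  apply: ler_wpM2l; first by rewrite mulr_ge0 ?sqr_ge0// mulr_ge0 ?sqr_ge0.
  exact: min_scaled_sqr_le (ltW t0) hd.
split=> on t t0.
  have m0 : 0 <= min_scaled sigma d t.
    have [[c _ [k _ <-]] _] := min_scaledP sigma n0 (ltW t0) hd.
    by case: hDd.
  apply: le_trans (tail (t * min_scaled sigma d t * S) t t0 _ _) _.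
  - by rewrite !mulr_ge0// ltW.
  - by rewrite (negbTE on) mul0r add0r.
  rewrite lee_fin ler_pM2l// ler_expR lerN2.
  have := sqr t (2 / n%:R) t0 _; rewrite divr_ge0 ?(ltW nR)// => /(_ isT).
  by rewrite !(mulrAC _ (n%:R^-1)).
move=> mS.
apply: le_trans (tail (t * min_scaled sigma d t * S / 2) t t0 _ _) _.
- lra.
- by rewrite on /=; lra.
rewrite lee_fin ler_pM2l// ler_expR lerN2.
have c0 : 0 <= (2 * n%:R)^-1 :> R by rewrite invr_ge0 mulr_ge0// ltW.
have := sqr t _ t0 c0.
rewrite [_^-1 * t ^+ 2]mulrC => /le_trans; apply.
by rewrite le_eqVlt; apply/orP; left; apply/eqP; field; lra.
Qed.
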